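(* There exist constants $c>0$ and $\kappa>0$ such that for all integers $n\ge 2$ and $\ell$ with $1\le \ell\le n$: (i) if $\ell> c\log^5 n$, then $\varphi(n,\ell)\ge \kappa\,\frac{\ell}{n}\,\varphi(n)$; (ii) if $\ell> c\log n$, then $\varphi(n,\ell)\ge \kappa\,\frac{\ell}{\log \ell}$.
   Context: $\mathbb{Z}_m^*=\{x\in\{0,\dots,m-1\}:\gcd(x,m)=1\}$; $\varphi(m)=|\mathbb{Z}_m^*|$ is Euler's totient function and the relative totient function is $\varphi(m,k)=|\{x\in\mathbb{Z}_m^*: x\le k\}|$. Convention: $\log x$ denotes $\max(\ln x,1)$. *)

(* Defs.v *)
From mathcomp Require Import all_boot.
From Stdlib Require Import Reals.

Definition rel_totient (m k : nat) : nat :=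
  count (fun x => coprime x m && (x <= k)%N) (iota 0 m).

(* Paper's convention: log x := max(ln x, 1). *)
Definition plog (x : R) : R := Rmax (ln x) 1.

(* Main.v *)
(** Let [f] be the indicator of the integers coprime to [n].  Since [f] is
    completely multiplicative and [ln x] is at least the sum of [ln p] over the
    primes [p] dividing [x],
      [rel_totient n l * ln l >= sum_(x <= l) f x * ln x
                              >= sum_(m <= l) f m * sum_(p <= l/m) f p * ln p].
    The primes dividing [n] contribute at most [ln n] to Chebyshev's [theta], so
    the inner sum is at least [a * l / m] as soon as [l / m >= C * log n].
    The term [m = 1] alone gives (ii).  For (i), take all
    [m <= z ~ l / (C * log n)]: removing the multiples of a prime [p] from a
    divisor-closed set multiplies its harmonic sum by at least [1 - 1/p], hence
    [sum_(m <= z) f m / m >= totient n / n * ln z], and [ln z >= ln l / 2].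
    Only [l >= (C' * log n) ^ 2] is needed for the last inequality. *)

From Stdlib Require Import Reals.
From mathcomp Require Import all_boot all_order all_algebra.
From mathcomp Require Import Rstruct.
From mathcomp Require Import ring lra zify.
Require Import Defs.

Set Implicit Arguments.
Unset Strict Implicit.
Unset Printing Implicit Defensive.
Import Order.TTheory GRing.Theory Num.Theory.
Local Open Scope ring_scope.

(** * Logarithms of natural numbers and of their prime divisors *)

Lemma ln_natM (a b : nat) : (0 < a)%N -> (0 < b)%N ->
  ln (a * b)%:R = ln a%:R + ln b%:R.
Proof.
by move=> a0 b0; rewrite natrM ln_mult //; apply/RltP; rewrite /= ltr0n.
Qed.

Lemma ln_nat_le (a b : nat) : (0 < a)%N -> (a <= b)%N -> ln a%:R <= ln b%:R.
Proof.
move=> a0; rewrite leq_eqVlt => /predU1P[->//|ab]; apply/ltW/RltP.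
by apply: ln_increasing; apply/RltP; rewrite /= ?ltr0n ?ltr_nat.
Qed.

Lemma ln_nat_ge0 (a : nat) : (0 < a)%N -> 0 <= ln a%:R.
Proof. by move=> a0; have <- : ln 1%:R = 0 := ln_1; apply: ln_nat_le. Qed.

Lemma ln_nat_prod (I : Type) (r : seq I) (P : pred I) (F : I -> nat) :
  (forall i, P i -> 0 < F i)%N ->
  ln (\prod_(i <- r | P i) F i)%:R = \sum_(i <- r | P i) ln (F i)%:R.
Proof.
move=> F0; elim: r => [|i r IH]; first by rewrite !big_nil; exact: ln_1.
rewrite !big_cons; case: ifPn => // Pi.
by rewrite ln_natM ?IH ?F0 ?prodn_cond_gt0.
Qed.

Lemma ln_natX (a k : nat) : (0 < a)%N -> ln (a ^ k)%:R = k%:R * ln a%:R.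
Proof.
move=> a0; elim: k => [|k IH]; first by rewrite mul0r; exact: ln_1.
by rewrite expnS ln_natM ?expn_gt0 ?a0 // IH -natr1 mulrDl mul1r addrC.
Qed.

(** Distinct primes are coprime, so each new prime divisor of [x] can be multiplied into the product
    by Gauss's lemma. *)
Lemma prod_prime_divisors_dvd (x l : nat) :
  (\prod_(1 <= p < l.+1 | prime p && (p %| x)) p %| x)%N.
Proof.
elim: l => [|l IH]; first by rewrite big_geq.
rewrite big_mkcond big_nat_recr //= -big_mkcond; case: ifP => [/andP[pl lx]|_];
  last by rewrite muln1.
rewrite Gauss_dvd ?IH // big_nat_cond.
elim/big_ind: _ => [|a b ca cb|i /andP[/andP[_ il] /andP[pi _]]].
- exact: coprime1n.
- by rewrite coprimeMl ca cb.
- rewrite prime_coprime // dvdn_prime2 //.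
  by apply/eqP => eil; rewrite eil ltnn in il.
Qed.

Lemma sum_ln_prime_divisors (x l : nat) : (0 < x)%N ->
  \sum_(1 <= p < l.+1 | prime p && (p %| x)%N) ln p%:R <= ln x%:R.
Proof.
move=> x0; rewrite -(@ln_nat_prod _ _ _ id); last by move=> p /andP[/prime_gt0].
apply: ln_nat_le.
  by rewrite prodn_cond_gt0 // => p /andP[/prime_gt0].
exact: dvdn_leq (prod_prime_divisors_dvd x l).
Qed.

(** * Prime factorisation of binomial coefficients *)

(** Legendre's formula padded with zero terms: a common range lets the formulas for [n], [k] and
    [n - k] be compared term by term. *)
Lemma logn_fact_extend (p m N : nat) : prime p -> (m <= N)%N ->
  logn p m`! = (\sum_(1 <= i < N.+1) m %/ p ^ i)%N.
Proof.
move=> pp mN; rewrite logn_fact // [RHS](big_cat_nat (n := m.+1)) //=.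
rewrite [X in (_ + X)%N]big_nat [X in (_ + X)%N]big1 ?addn0 // => i /andP[mi _].
by rewrite divn_small // (ltn_trans mi) // ltn_expl // prime_gt1.
Qed.

Lemma sum_pow_le_trunc_log (p n N : nat) : (1 < p)%N ->
  (\sum_(1 <= i < N.+1) (p ^ i <= n)%N <= trunc_log p n)%N.
Proof.
move=> p1; elim: N => [|N IH]; first by rewrite big_geq.
rewrite big_nat_recr //=; case: (leqP (p ^ N.+1)) => [pN|_]; last by rewrite addn0.
rewrite addn1; apply: leq_ltn_trans (_ : N < _)%N.
  apply: leq_trans (_ : \sum_(1 <= i < N.+1) 1 <= _)%N.
    by apply: leq_sum => i _; exact: leq_b1.
  by rewrite sum_nat_const_nat muln1 subn1.
by apply: trunc_log_max.
Qed.

(** By Legendre, the exponent counts the carries when adding [k] and [n - k] in base [p]: at most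
    one for each [i] with [p ^ i <= n], none for larger [i]. *)
Lemma pow_logn_bin_le (p n k : nat) : prime p -> (0 < n)%N -> (k <= n)%N ->
  (p ^ logn p 'C(n, k) <= n)%N.
Proof.
move=> pp n0 kn; apply: leq_trans (trunc_logP (prime_gt1 pp) n0).
rewrite leq_exp2l ?prime_gt1 //.
have C0 : (0 < 'C(n, k))%N by rewrite bin_gt0.
have := congr1 (logn p) (bin_fact kn).
rewrite !lognM ?muln_gt0 ?fact_gt0 //.
rewrite (logn_fact_extend pp kn) (logn_fact_extend pp (leq_subr k n)).
rewrite (logn_fact_extend pp (leqnn n)) => E.
apply: leq_trans (@sum_pow_le_trunc_log p n n (prime_gt1 pp)).
rewrite -(leq_add2r (\sum_(1 <= i < n.+1) k %/ p ^ i +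
                     \sum_(1 <= i < n.+1) (n - k) %/ p ^ i)) E.
rewrite -!big_split /=; apply: leq_sum => i _.
have q0 : (0 < p ^ i)%N by rewrite expn_gt0 prime_gt0.
case: (leqP (p ^ i) n) => [_|qn]; last by rewrite divn_small.
(* [divnD] exhibits the carry as a boolean. *)
rewrite -{1}(subnKC kn) divnD // addnC leq_add2r; exact: leq_b1.
Qed.

(** Pascal's rule splits the next central coefficient into two terms, each at least
    ['C(k.*2, k)]. *)
Lemma central_bin_ge (k : nat) : (2 ^ k <= 'C(k.*2, k))%N.
Proof.
elim: k => [//|k IH]; rewrite doubleS expnS mul2n -addnn.
rewrite binS leq_add // (leq_trans IH) // ?binS ?leq_addl //.
by case: (k) => //= j; rewrite binS leq_addr.
Qed.

(** A prime above [n] has exponent 0, since [pow_logn_bin_le] would otherwise force [p <= n]. *)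
Lemma bin_prime_prod (n k : nat) : (0 < n)%N -> (k <= n)%N ->
  ('C(n, k) = \prod_(1 <= p < n.+1 | prime p) p ^ logn p 'C(n, k))%N.
Proof.
move=> n0 kn; set C := 'C(n, k).
have C0 : (0 < C)%N by rewrite bin_gt0.
rewrite -{1}(partnT C0) (@widen_partn (C + n)) ?leq_addr //.
rewrite (big_cat_nat (n := n.+1)) //=; last by rewrite ltnS leq_addl.
rewrite [X in (_ * X)%N]big_nat_cond [X in (_ * X)%N]big1 ?muln1; last first.
  move=> p /andP[/andP[np _] _].
  have [pp|npp] := boolP (prime p); last by rewrite lognE (negbTE npp).
  have := pow_logn_bin_le pp n0 kn; rewrite -/C.
  case: (logn p C) => // v; rewrite expnS => pv.
  have pv0 : (0 < p ^ v)%N by rewrite expn_gt0 prime_gt0.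
  by have := leq_trans np (leq_trans (leq_pmulr p pv0) pv); rewrite ltnn.
rewrite big_ltn_cond //= mul1n [RHS]big_mkcond; apply: eq_bigr => p _.
by rewrite lognE; case: prime.
Qed.

(** * Chebyshev's lower bound for theta *)

Lemma count_squares_le (N M : nat) :
  ((\sum_(1 <= p < M.+1) (p * p <= N)%N) ^ 2 <= N)%N.
Proof.
elim: M => [|M IH]; first by rewrite big_geq.
rewrite big_nat_recr //=; case: (leqP (M.+1 * M.+1)) => [MN|_]; last by rewrite addn0.
apply: leq_trans MN; rewrite -mulnn leq_mul // addn1 ltnS;
(apply: leq_trans (_ : \sum_(1 <= i < M.+1) 1 <= _)%N;
    [by apply: leq_sum => i _; exact: leq_b1
  | by rewrite sum_nat_const_nat muln1 subn1]).
Qed.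

(** A prime with [p * p > k.*2] has exponent at most 1 and costs at most [ln p]; any other prime
    power is at most [k.*2]. The second sum counts all integers instead of primes, which is enough
    for an error of order [sqrt k * ln k]. *)
Lemma ln_central_bin_le (k : nat) : (0 < k)%N ->
  k%:R * ln 2%:R <= \sum_(1 <= p < k.*2.+1 | prime p) ln p%:R
   + (\sum_(1 <= p < k.*2.+1) (p * p <= k.*2)%N)%:R * ln k.*2%:R.
Proof.
move=> k0; have n0 : (0 < k.*2)%N by rewrite double_gt0.
have kn : (k <= k.*2)%N by rewrite -addnn leq_addl.
rewrite -ln_natX //; apply: (le_trans (ln_nat_le _ (central_bin_ge k))).
  by rewrite expn_gt0.
rewrite (bin_prime_prod n0 kn) ln_nat_prod; last first.
  by move=> p pp; rewrite expn_gt0 prime_gt0.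
rewrite natr_sum mulr_suml [X in _ + X](bigID prime) /=.
rewrite addrA -big_split /=; apply: ler_wpDr.
  by apply: sumr_ge0 => p _; rewrite mulr_ge0 ?ler0n ?ln_nat_ge0.
apply: ler_sum => p pp; set v := logn p _.
have := pow_logn_bin_le pp n0 kn; rewrite -/v => pv.
have pv0 : (0 < p ^ v)%N by rewrite expn_gt0 prime_gt0.
have lp0 := ln_nat_ge0 (prime_gt0 pp).
case: (leqP (p * p) k.*2) => pk.
  rewrite mul1r; apply: ler_wpDl => //; exact: ln_nat_le.
rewrite mul0r addr0; apply: ln_nat_le => //.
have : (v <= 1)%N.
  rewrite leqNgt; apply/negP => v2; have := leq_trans (leq_pexp2l (prime_gt0 pp) v2) pv.
  by rewrite expnS expn1 leqNgt pk.
by case: (v) => [|[|//]] _; rewrite ?expn1 ?prime_gt0.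
Qed.

Lemma ln_le_subr1 (x : R) : 0 < x -> ln x <= x - 1.
Proof.
move=> /RltP x0; have /RleP := exp_ineq1_le (ln x).
by rewrite exp_ln // RplusE lerBrDl.
Qed.

Lemma ln_exprn (x : R) (k : nat) : 0 < x -> ln (x ^+ k) = k%:R * ln x.
Proof.
move=> x0; elim: k => [|k IH]; first by rewrite mul0r; exact: ln_1.
rewrite exprS ln_mult; try by apply/RltP; rewrite ?exprn_gt0.
by rewrite IH RplusE -natr1 mulrDl mul1r addrC.
Qed.

(** This is [ln x <= x - 1] at [x = 1/2]. *)
Lemma ln2_ge : 1 / 2 <= ln 2%:R :> R.
Proof.
have := @ln_le_subr1 2^-1; have : ln 2%:R + ln 2^-1 = 0.
  rewrite -RplusE -ln_mult; try by apply/RltP; rewrite ?invr_gt0.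
  by rewrite RmultE divff; [exact: ln_1 | rewrite pnatr_eq0].
by lra.
Qed.

Lemma chebyshev_theta_lower : exists a T : R, 0 < a /\ forall t : nat,
  T <= t%:R -> a * t%:R <= \sum_(1 <= p < t.+1 | prime p) ln p%:R.
Proof.
(* The main term is at least [N / 4] and, once [w >= 32], the error [4 * w ^ 3] is at most [N / 8].
   The remaining [N / 8] is at least [t / 16] because [t <= N + 1]; the [+ 1] in the threshold
   covers odd [t]. *)
exists (1 / 16), (32 ^+ 4 + 1); split=> [|t Tt]; first by lra.
set k := t./2; set N := k.*2.
have tE : t%:R = (odd t)%:R + N%:R :> R by rewrite -natrD odd_double_half.
have ot0 : 0 <= (odd t)%:R :> R by rewrite ler0n.
have ot1 : (odd t)%:R <= 1 :> R by rewrite lern1 leq_b1.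
have N32 : 32 ^+ 4 <= N%:R :> R by lra.
have k0 : (0 < k)%N.
  by rewrite -double_gt0 -(ltr0n R); apply: lt_le_trans N32; rewrite exprn_gt0.
have kE : k%:R = N%:R / 2%:R :> R by rewrite /N -muln2 natrM mulfK ?pnatr_eq0.
(* With [N = w ^ 4], the primes up to [sqrt N] cost at most
   [sqrt N * ln N <= w ^ 2 * (4 * w)], negligible against [N]. *)
set w : R := Num.sqrt (Num.sqrt N%:R).
have w2 : w ^+ 2 = Num.sqrt N%:R by rewrite sqr_sqrtr ?sqrtr_ge0.
have w4 : w ^+ 4 = N%:R by rewrite (exprM w 2 2) w2 sqr_sqrtr ?ler0n.
have w0 : 0 <= w by rewrite sqrtr_ge0.
have w32 : 32 <= w by rewrite -(@ler_pXn2r _ 4) ?nnegrE ?w4.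
have lnN : ln N%:R <= 4 * w.
  rewrite -w4 ln_exprn; last by lra.
  by have := @ln_le_subr1 w; lra.
have sN : (\sum_(1 <= p < N.+1) (p * p <= N)%N)%:R <= w ^+ 2.
  by rewrite w2 -[leLHS]ger0_norm ?ler0n // -sqrtr_sqr ler_wsqrtr // -natrX ler_nat count_squares_le.
have := ln_central_bin_le k0; rewrite -/N => main.
have : (\sum_(1 <= p < N.+1) (p * p <= N)%N)%:R * ln N%:R <= w ^+ 2 * (4 * w).
  by rewrite ler_pM ?ler0n ?ln_nat_ge0 ?double_gt0.
have thNt : \sum_(1 <= p < N.+1 | prime p) ln p%:R <=
            \sum_(1 <= p < t.+1 | prime p) ln p%:R.
  have Nt : (N.+1 <= t.+1)%N by rewrite ltnS -[leqRHS]odd_double_half leq_addl.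
  rewrite [leRHS](big_cat_nat (n := N.+1)) //= lerDl.
  by apply: sumr_ge0 => p /prime_gt0; exact: ln_nat_ge0.
have : 0 <= w ^+ 3 * (w / 8 - 4) by rewrite mulr_ge0 ?exprn_ge0 //; lra.
have -> : w ^+ 3 * (w / 8 - 4) = w ^+ 4 / 8 - w ^+ 2 * (4 * w) by ring.
rewrite w4.
have : k%:R * (1 / 2) <= k%:R * ln 2%:R.
  by rewrite ler_wpM2l // ?ler0n // ln2_ge.
by move: main; rewrite kE; lra.
Qed.

(** * Counting integers coprime to [n] with logarithmic weights *)

Lemma sum_multiples (V : nmodType) (d l : nat) (F : nat -> V) : (0 < d)%N ->
  \sum_(1 <= x < l.+1 | (d %| x)%N) F x =
  \sum_(1 <= m < (l %/ d).+1) F (d * m)%N.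
Proof.
move=> d0; elim: l => [|l IH]; first by rewrite div0n !big_geq.
rewrite big_mkcond big_nat_recr //= -big_mkcond IH divnS //.
case: ifP => [dl|_]; last by rewrite addr0.
rewrite add1n [RHS]big_nat_recr //=; congr (_ + F _).
by have := divnS l d0; rewrite dl add1n => <-; rewrite mulnC divnK.
Qed.

(** Both sides run over the pairs [(d, m)] of positive integers with [d * m <= l], grouped by
    product on the left and by [m] on the right. *)
Lemma sum_divisors_exchange (V : nmodType) (l : nat) (G : nat -> nat -> V) :
  \sum_(1 <= x < l.+1) \sum_(1 <= d < l.+1 | (d %| x)%N) G d (x %/ d)%N =
  \sum_(1 <= m < l.+1) \sum_(1 <= d < (l %/ m).+1) G d m.
Proof.
have widen (d : nat) (F : nat -> V) : \sum_(1 <= m < (l %/ d).+1) F m =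
    \sum_(1 <= m < l.+1 | (m < (l %/ d).+1)%N) F m.
  by rewrite (big_nat_widen _ _ l.+1) // ltnS leq_div.
rewrite (exchange_big_dep_nat xpredT) //=.
under [RHS]eq_bigr do rewrite widen.
rewrite [RHS](exchange_big_dep_nat xpredT) //=.
apply: eq_big_nat => d /andP[d0 _]; rewrite sum_multiples // widen.
rewrite [LHS]big_nat_cond [RHS]big_nat_cond; apply: eq_big => [m|m _].
  case: (posnP m) => [->//|m0].
  by rewrite !ltnS !leq_divRL // mulnC.
by rewrite mulKn.
Qed.

Definition coprime_theta (n t : nat) : R :=
  \sum_(1 <= p < t.+1 | prime p && coprime p n) ln p%:R.

Definition coprime_count (n l : nat) : nat :=
  (\sum_(1 <= x < l.+1) coprime x n)%N.

Lemma coprime_theta_ge (n t : nat) : (0 < n)%N ->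
  \sum_(1 <= p < t.+1 | prime p) ln p%:R - ln n%:R <= coprime_theta n t.
Proof.
move=> n0; rewrite lerBlDr (bigID (fun p => coprime p n)) /= lerD2l.
apply: le_trans (sum_ln_prime_divisors t n0); rewrite le_eqVlt; apply/predU1P; left.
by apply: eq_bigl => p; case: (boolP (prime p)) => //= pp; rewrite prime_coprime // negbK.
Qed.

Lemma coprime_count_ln_ge (n l : nat) : (0 < l)%N ->
  \sum_(1 <= m < l.+1 | coprime m n) coprime_theta n (l %/ m) <=
  (coprime_count n l)%:R * ln l%:R.
Proof.
move=> l0.
pose G p m : R :=
  if prime p && coprime p n && coprime m n then ln p%:R else 0.
have -> : \sum_(1 <= m < l.+1 | coprime m n) coprime_theta n (l %/ m) =
          \sum_(1 <= m < l.+1) \sum_(1 <= p < (l %/ m).+1) G p m.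
  rewrite big_mkcond; apply: eq_bigr => m _; rewrite /G /coprime_theta.
  case: (coprime m n); last by rewrite big1 // => p _; rewrite andbF.
  by rewrite big_mkcond; apply: eq_bigr => p _; rewrite andbT.
rewrite -sum_divisors_exchange natr_sum mulr_suml.
rewrite big_nat [leRHS]big_nat; apply: ler_sum => x /andP[x0 xl].
(* For [x = p * m], coprimality of both factors to [n] is coprimality of [x], so the condition on
   [x] leaves the sum over [p]. *)
have GE p : (p %| x)%N -> G p (x %/ p)%N =
    if prime p && coprime x n then ln p%:R else 0.
  move=> px; rewrite /G -{2}(divnK px) coprimeMl -andbA; congr (if _ && _ then _ else _).
  by rewrite andbC.
rewrite (eq_bigr _ GE); case: (coprime x n); last first.
  by rewrite mul0r big1 // => p _; rewrite andbF.
rewrite mul1r; apply: le_trans (ln_nat_le x0 xl).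
apply: le_trans (sum_ln_prime_divisors l x0); rewrite le_eqVlt; apply/predU1P; left.
rewrite big_mkcond [RHS]big_mkcond; apply: eq_bigr => p _.
by rewrite andbT andbC; case: (p %| x)%N; case: (prime p).
Qed.

(** * Harmonic sums over integers coprime to [n] *)

(** With [s] the primes of [n] this is coprimality to [n]; the list form allows induction on one
    prime at a time. *)
Definition avoids (s : seq nat) (m : nat) : bool :=
  all (fun p => ~~ (p %| m)%N) s.

(** The terms lost are those with [m = p * m']. Then [m'] avoids [s] as well and [m' <= z %/ p], so
    the loss is at most [1/p] times the whole sum. *)
Lemma sum_recip_avoids_cons (p : nat) (s : seq nat) (z : nat) : (0 < p)%N ->
  (1 - p%:R^-1) * \sum_(1 <= m < z.+1 | avoids s m) m%:R^-1 <=
  \sum_(1 <= m < z.+1 | avoids (p :: s) m) m%:R^-1 :> R.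
Proof.
move=> p0; rewrite mulrBl mul1r lerBlDr.
rewrite [leLHS](bigID (fun m => ~~ (p %| m)%N)) /=.
under eq_bigl do rewrite andbC.
rewrite lerD2l.
have -> : \sum_(1 <= m < z.+1 | avoids s m && ~~ ~~ (p %| m)%N) m%:R^-1 =
    \sum_(1 <= m < z.+1 | (p %| m)%N) if avoids s m then m%:R^-1 else 0 :> R.
  by rewrite -big_mkcondr; apply: eq_bigl => m; rewrite negbK andbC.
rewrite sum_multiples // mulr_sumr.
rewrite [leRHS]big_mkcond [leRHS](big_cat_nat (n := (z %/ p).+1)) //=; last first.
  by rewrite ltnS leq_div.
apply: ler_wpDr.
  by apply: sumr_ge0 => m _; case: ifP => // _; rewrite mulr_ge0 ?invr_ge0 ?ler0n.
apply: ler_sum => m _; case: ifPn => [sm|_]; last first.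
  by case: ifP => // _; rewrite mulr_ge0 ?invr_ge0 ?ler0n.
rewrite ifT ?natrM ?invfM //.
by apply: sub_all sm => q; apply: contra => /dvdn_mull; apply.
Qed.

Lemma sum_recip_avoids (s : seq nat) (z : nat) : all (leq 1) s ->
  \prod_(p <- s) (1 - p%:R^-1) * \sum_(1 <= m < z.+1) m%:R^-1 <=
  \sum_(1 <= m < z.+1 | avoids s m) m%:R^-1 :> R.
Proof.
elim: s => [_|p s IH /= /andP[p0 s0]]; first by rewrite big_nil mul1r.
apply: le_trans (sum_recip_avoids_cons s z p0).
rewrite big_cons -mulrA ler_wpM2l ?IH // subr_ge0 invf_le1 ?ltr0n //.
by rewrite ler1n.
Qed.

Lemma totient_prod (n : nat) : (0 < n)%N ->
  (totient n)%:R = n%:R * \prod_(p <- primes n) (1 - p%:R^-1) :> R.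
Proof.
move=> n0; rewrite totientE // [in X in _ = X * _](prod_prime_decomp n0) prime_decompE big_map /=.
rewrite !natr_prod -big_split /= big_seq [RHS]big_seq; apply: eq_bigr => p pn.
have pp : prime p by move: pn; rewrite mem_primes => /and3P[].
have p0 : p%:R != 0 :> R by rewrite pnatr_eq0 -lt0n prime_gt0.
rewrite -[in RHS](prednK (_ : 0 < logn p n)%N) ?logn_gt0 // expnS !natrM.
rewrite -subn1 natrB ?prime_gt0 //.
by rewrite [RHS]mulrBr mulr1 [X in _ = _ - X]mulrAC divff // mulrBl.
Qed.

Lemma coprime_avoids_primes (n m : nat) : (0 < n)%N -> (0 < m)%N ->
  coprime m n = avoids (primes n) m.
Proof.
move=> n0 m0; rewrite coprime_has_primes // -all_predC /avoids.
apply: eq_in_all => p; rewrite mem_primes => /and3P[pp _ _] /=.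
by rewrite mem_primes pp m0.
Qed.

(** Each increment of the logarithm is [ln (1 + 1/(z+1)) <= 1/(z+1)]. *)
Lemma harmonic_ge_ln (z : nat) : ln z.+1%:R <= \sum_(1 <= m < z.+1) m%:R^-1.
Proof.
elim: z => [|z IH]; first by rewrite big_geq //; have -> : ln 1%:R = 0 := ln_1.
rewrite big_nat_recr //=.
have z0 : 0 < z.+1%:R :> R by rewrite ltr0n.
have -> : z.+2%:R = z.+1%:R * (1 + z.+1%:R^-1) :> R.
  by rewrite mulrDr mulr1 divff ?gt_eqF // natr1.
rewrite ln_mult; try by apply/RltP; rewrite ?addr_gt0 ?invr_gt0.
rewrite lerD //; apply: le_trans (ln_le_subr1 _) _; first by rewrite addr_gt0 ?invr_gt0.
by rewrite addrC addKr.
Qed.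

Lemma sum_recip_coprime_ge (n z : nat) : (0 < n)%N ->
  (totient n)%:R / n%:R * ln z.+1%:R <=
  \sum_(1 <= m < z.+1 | coprime m n) m%:R^-1.
Proof.
move=> n0.
have -> : \sum_(1 <= m < z.+1 | coprime m n) m%:R^-1 =
  \sum_(1 <= m < z.+1 | avoids (primes n) m) m%:R^-1 :> R.
  rewrite big_nat_cond [RHS]big_nat_cond; apply: eq_bigl => m.
  by case: (ltnP 0 m) => //= m0; rewrite coprime_avoids_primes.
have sp : all (leq 1) (primes n).
  by apply/allP => p; rewrite mem_primes => /and3P[/prime_gt0].
apply: le_trans (sum_recip_avoids z sp).
rewrite ler_pM ?divr_ge0 ?ler0n ?ln_nat_ge0 ?harmonic_ge_ln //.
by rewrite totient_prod // mulrAC divff ?mul1r // pnatr_eq0 -lt0n.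
Qed.

(** * Assembling the two bounds *)

(** The two ranges differ only at 0 and possibly at [n], neither of which is coprime to [n] when
    [n > 1]. *)
Lemma rel_totientE (n l : nat) : (1 < n)%N -> (l <= n)%N ->
  rel_totient n l = coprime_count n l.
Proof.
move=> n1 ln; rewrite /rel_totient -sum1_count /coprime_count.
have -> : iota 0 n = index_iota 0 n by rewrite /index_iota subn0.
have cn : coprime n n = false by rewrite /coprime gcdnn; case: eqP n1 => // ->.
have c0 : coprime 0 n = false by rewrite /coprime gcd0n; case: eqP n1 => // ->.
have -> : (\sum_(0 <= x < n | coprime x n && (x <= l)) 1 =
           \sum_(0 <= x < n.+1 | coprime x n && (x <= l)) 1)%N.
  by rewrite [RHS]big_mkcond big_nat_recr //= cn addn0 -big_mkcond.
rewrite -(big_nat_widen 0 l.+1 n.+1 (fun x => coprime x n)) //.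
by rewrite big_ltn_cond // c0 big_mkcond.
Qed.

Lemma plog_ge1 (x : R) : 1 <= plog x.
Proof. by apply/RleP; exact: Rmax_r. Qed.

Lemma ln_le_plog (x : R) : ln x <= plog x.
Proof. by apply/RleP; exact: Rmax_l. Qed.

Lemma coprime_theta_ge0 (n t : nat) : 0 <= coprime_theta n t.
Proof. by apply: sumr_ge0 => p /andP[/prime_gt0 p0 _]; exact: ln_nat_ge0. Qed.

Lemma coprime_theta_linear : exists a C : R, 0 < a /\ 1 <= C /\
  forall n t : nat, (0 < n)%N -> C * plog n%:R <= t%:R ->
  a * t%:R <= coprime_theta n t.
Proof.
have [a [T [a0 theta_ge]]] := chebyshev_theta_lower.
have ai0 : 0 <= 2 / a by rewrite divr_ge0 // ltW.
have T0 := normr_ge0 T.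
(* The summand [|T|] puts [t] in Chebyshev's range, [2 / a] makes [ln n] at most half of [a * t],
   and 1 ensures [1 <= C]. *)
exists (a / 2), (`|T| + 2 / a + 1); split; first by lra.
split=> [|n t n0 tL]; first by lra.
have L1 := plog_ge1 n%:R; have lnL := ln_le_plog n%:R.
have Tt : T <= t%:R.
  apply: le_trans (ler_norm T) _; apply: le_trans tL.
  by rewrite -[leLHS]mulr1 ler_pM //; lra.
have Lt : plog n%:R <= a / 2 * t%:R.
  have aL : 2 / a * plog n%:R <= t%:R.
    by apply: le_trans tL; rewrite ler_wpM2r //; lra.
  have -> : plog n%:R = a / 2 * (2 / a * plog n%:R) by field; rewrite gt_eqF.
  by rewrite ler_wpM2l //; lra.
by have := theta_ge t Tt; have := coprime_theta_ge t n0; lra.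
Qed.

Lemma coprime_count_ge_theta (n l : nat) : (0 < l)%N ->
  coprime_theta n l <= (coprime_count n l)%:R * ln l%:R.
Proof.
move=> l0; apply: le_trans (coprime_count_ln_ge n l0).
rewrite big_ltn_cond // coprime1n divn1 lerDl.
by apply: sumr_ge0 => m _; exact: coprime_theta_ge0.
Qed.

(** The factor 1/4 is one half for rounding in [l %/ m] times one half for [ln z.+1] against
    [ln l]. *)
Lemma coprime_count_ge_totient (a : R) (n l Q : nat) :
  0 < a -> (0 < n)%N -> (1 < Q)%N -> (Q * Q <= l)%N ->
  (forall t : nat, (Q <= t)%N -> a * t%:R <= coprime_theta n t) ->
  a / 4 * (l%:R / n%:R) * (totient n)%:R <= (coprime_count n l)%:R.
Proof.
move=> a0 n0 Q1 QQl thQ; have Q0 : (0 < Q)%N by exact: ltnW.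
have l1 : (1 < l)%N by apply: leq_trans QQl; rewrite (leq_trans Q1) // leq_pmulr.
have l0 : (0 < l)%N by exact: ltnW.
(* This is the largest [m] for which [l %/ m] still reaches the threshold [Q]. *)
set z := (l %/ Q)%N.
have zl : (z.+1 <= l.+1)%N by rewrite ltnS leq_div.
(* From [Q * Q <= l] follows [Q <= z], hence [l < z.+1 * Q <= z.+1 * z.+1]. *)
have lz : (l <= z.+1 * z.+1)%N.
  apply: ltnW; apply: leq_trans (_ : z.+1 * Q <= _)%N; first exact: ltn_ceil.
  by rewrite leq_mul2l leqW // leq_divRL.
have lnl0 : 0 < ln l%:R.
  apply/RltP; rewrite -[X in Rlt X _]ln_1.
  by apply: ln_increasing; apply/RltP; rewrite ?ltr01 ?ltr1n.
have lnz : ln l%:R <= 2 * ln z.+1%:R.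
  by apply: le_trans (ln_nat_le l0 lz) _; rewrite ln_natM //; lra.
rewrite -(ler_pM2r lnl0); apply: le_trans (coprime_count_ln_ge n l0).
rewrite [leRHS](big_cat_nat (n := z.+1)) //=; apply: ler_wpDr.
  by apply: sumr_ge0 => m _; exact: coprime_theta_ge0.
apply: le_trans (_ : a / 2 * l%:R * \sum_(1 <= m < z.+1 | coprime m n) m%:R^-1 <= _).
  have := sum_recip_coprime_ge z n0.
  set S := \sum_(_ <= _ < _ | _) _ => S_ge.
  have al0 : 0 <= a / 2 * l%:R by rewrite mulr_ge0 ?ler0n //; lra.
  apply: le_trans (ler_wpM2l al0 S_ge).
  have q0 : 0 <= a / 2 * l%:R * ((totient n)%:R / n%:R).
    by rewrite mulr_ge0 // divr_ge0 ?ler0n.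
  rewrite [leRHS]mulrA.
  apply: le_trans (_ : a / 2 * l%:R * ((totient n)%:R / n%:R) * (ln l%:R / 2) <= _).
    by rewrite le_eqVlt; apply/predU1P; left; field; rewrite pnatr_eq0 -lt0n.
  by apply: ler_wpM2l => //; lra.
rewrite mulr_sumr [leLHS]big_nat_cond [leRHS]big_nat_cond.
apply: ler_sum => m /andP[/andP[m0 mz] _].
have Qf : (Q <= l %/ m)%N by rewrite leq_divRL // mulnC -leq_divRL.
apply: le_trans (thQ _ Qf); rewrite ler_pdivrMr ?ltr0n //.
(* Since [l %/ m] is at least 1, rounding down loses at most a factor 2. *)
have : (l <= 2 * (l %/ m) * m)%N.
  apply: ltnW; apply: leq_trans (ltn_ceil l m0) _; rewrite leq_mul2r.
  by have := leq_trans Q0 Qf; lia.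
by rewrite -(ler_nat R) !natrM => /(ler_wpM2l (ltW a0)); lra.
Qed.

Lemma rel_totient_bounds : exists c kappa : R, 0 < c /\ 0 < kappa /\
  forall n l : nat, (1 < n)%N -> (0 < l)%N -> (l <= n)%N ->
    (c * plog n%:R ^+ 5 < l%:R ->
       kappa * (l%:R / n%:R) * (totient n)%:R <= (rel_totient n l)%:R) /\
    (c * plog n%:R < l%:R ->
       kappa * (l%:R / plog l%:R) <= (rel_totient n l)%:R).
Proof.
have [a [C [a0 [C1 theta_ge]]]] := coprime_theta_linear.
have C0 : 0 < C by lra.
(* In (i) the integer threshold [Q] is at most [2 * C * L], so [Q * Q <= 4 * C ^ 2 * L ^ 2], and
   [L >= 1] bounds this by the fifth power. In (ii), [C >= 1] gives [C <= 4 * C ^ 2]. *)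
exists (4 * C ^+ 2), (a / 4); split; first by rewrite mulr_gt0 ?exprn_gt0.
split=> [|n l n1 l0 ln]; first by lra.
rewrite rel_totientE //; have n0 := ltnW n1.
have L1 := plog_ge1 n%:R; set L := plog n%:R in L1 *.
have L0 : 0 <= L by lra.
split=> lL.
- have CL1 : 1 <= C * L by rewrite -[leLHS]mulr1 ler_pM.
  have CL0 : 0 <= C * L by lra.
  have /andP[QCL CLQ] := truncn_itv CL0.
  apply: (coprime_count_ge_totient (Q := (Num.truncn (C * L)).+1) a0 n0).
  + by rewrite -(ltr1n R); apply: le_lt_trans CLQ.
  + have Q2 : (Num.truncn (C * L)).+1%:R <= 2 * (C * L) by rewrite -natr1; lra.
    rewrite -(ler_nat R) natrM; apply: ltW; apply: le_lt_trans lL.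
    apply: le_trans (ler_pM _ _ Q2 Q2) _; rewrite ?ler0n //.
    have -> : 2 * (C * L) * (2 * (C * L)) = 4 * C ^+ 2 * L ^+ 2 by ring.
    rewrite ler_wpM2l ?ler_weXn2l // mulr_ge0 ?exprn_ge0 //; lra.
  + move=> t Qt; apply: theta_ge => //; apply: ltW.
    by apply: lt_le_trans CLQ _; rewrite ler_nat.
- have lC : C * L <= l%:R.
    apply: le_trans (ltW lL); rewrite ler_wpM2r //.
    rewrite expr2 mulrA ler_peMl ?ltW //; lra.
  have := le_trans (theta_ge n l n0 lC) (coprime_count_ge_theta n l0).
  have P1 := plog_ge1 l%:R; have P0 : 0 < plog l%:R by lra.
  rewrite mulrA ler_pdivrMr // => al.
  apply: le_trans (_ : a * l%:R <= _); first by rewrite ler_wpM2r ?ler0n //; lra.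
  by apply: le_trans al _; rewrite ler_wpM2l ?ler0n ?ln_le_plog.
Qed.

Open Scope R_scope.

Theorem mainTheorem3 :
  exists c kappa : R, 0 < c /\ 0 < kappa /\
    forall n l : nat, (2 <= n)%nat -> (1 <= l)%nat -> (l <= n)%nat ->
      (INR l > c * (plog (INR n)) ^ 5 ->
         INR (rel_totient n l) >= kappa * (INR l / INR n) * INR (totient n)) /\
      (INR l > c * plog (INR n) ->
         INR (rel_totient n l) >= kappa * (INR l / plog (INR l))).
Proof.
have [c [kappa [c0 [kappa0 bounds]]]] := rel_totient_bounds.
exists c, kappa; split; first exact/RltP.
split=> [|n l n2 l1 ln]; first exact/RltP.
have [large small] := bounds n l n2 l1 ln.
by split=> /Rgt_lt/RltP; rewrite !RealsE => hl; apply/Rle_ge/RleP;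
  [exact: large | exact: small].
Qed.
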